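(* There exists a simplicial monoid $M_*$ whose geometric realization $|M_*|$ is connected and not contractible, such that the map $|M_*| \longrightarrow |UM_*|$ induced by group completion is null homotopic.
   Context: For a (discrete) monoid $M$, let $UM$ denote the universal group generated by $M$, i.e. the group generated by the set of symbols $\{[m] \mid m\in M\}$ modulo the relations $[m][n]=[mn]$ for $m,n\in M$. The natural homomorphism $M\to UM$, $m\mapsto [m]$, is called the group completion of $M$; it is initial among homomorphisms from $M$ into a group. A simplicial monoid $M_*$ is a simplicial object in the category of monoids. Applying the functor $U$ in each simplicial degree gives a simplicial group $UM_*$, and the degreewise group completion homomorphisms $M_k\to UM_k$ form a map of simplicial monoids $M_*\to UM_*$. Here $|\cdot|$ denotes the geometric realization of the underlying simplicial set, and the map $|M_*|\to|UM_*|$ is the geometric realization of $M_*\to UM_*$. A simplicial monoid is called connected, respectively noncontractible, if its geometric realization is. *)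

(* Defs.v *)
From HB Require Import structures.
From Stdlib Require Import Relation_Operators.
From mathcomp Require Import all_boot all_order all_algebra.
From mathcomp Require Import all_classical all_reals all_analysis.
Import Order.TTheory GRing.Theory Num.Theory.
Import numFieldNormedType.Exports.

Set Implicit Arguments.
Unset Strict Implicit.
Unset Printing Implicit Defensive.

Local Open Scope classical_set_scope.
Local Open Scope ring_scope.
Local Open Scope quotient_scope.

Section GeneratedEquivalence.
Context {T : choiceType} (r : T -> T -> Prop).

Definition eqv_closure (x y : T) : bool := `[< clos_refl_sym_trans T r x y >].

Lemma eqv_closure_refl : reflexive eqv_closure.
Proof. by move=> x; apply/asboolP; exact: rst_refl. Qed.

Lemma eqv_closure_sym : symmetric eqv_closure.
Proof. by move=> x y; apply/asboolP/asboolP; exact: rst_sym. Qed.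

Lemma eqv_closure_trans : transitive eqv_closure.
Proof.
by move=> y x z /asboolP xy /asboolP yz; apply/asboolP; exact: rst_trans yz.
Qed.

Definition generated_equiv : equiv_rel T :=
  EquivRel eqv_closure eqv_closure_refl eqv_closure_sym eqv_closure_trans.

End GeneratedEquivalence.

Lemma eqv_closure_homo (T T' : choiceType) (r : T -> T -> Prop)
    (r' : T' -> T' -> Prop) (h : T -> T') :
  (forall x y, r x y -> eqv_closure r' (h x) (h y)) ->
  forall x y, eqv_closure r x y -> eqv_closure r' (h x) (h y).
Proof.
move=> rr' x y /asboolP; elim=> {x y} [x y /rr' //|x|x y _|x y z _ xy _ yz].
- exact: eqv_closure_refl.
- by rewrite eqv_closure_sym.
- exact: eqv_closure_trans yz.
Qed.

Section UniversalGroup.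
Context {M : monoidType}.

(* The letter (m, false) stands for [m] and (m, true) for its inverse.        *)
Definition ug_word := seq (M * bool).

Inductive ug_rel : ug_word -> ug_word -> Prop :=
| ug_cancel (u v : ug_word) (m : M) (b : bool) :
    ug_rel (u ++ [:: (m, b); (m, ~~ b)] ++ v) (u ++ v)
| ug_mul (u v : ug_word) (m n : M) :
    ug_rel (u ++ [:: (m, false); (n, false)] ++ v)
           (u ++ [:: ((m * n)%g, false)] ++ v).

End UniversalGroup.
Arguments ug_word : clear implicits.

Definition universal_group (M : monoidType) : Type :=
  {eq_quot (generated_equiv (@ug_rel M))}.

Section UniversalGroupTheory.
Context {M : monoidType}.
Local Notation U := (universal_group M).

HB.instance Definition _ := Choice.on U.
HB.instance Definition _ := Quotient.on U.

Definition ug_inv_word (w : ug_word M) : ug_word M :=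
  rev [seq (a.1, ~~ a.2) | a <- w].

Definition ug_one : U := \pi_U [::].
Definition ug_prod (x y : U) : U := \pi_U (repr x ++ repr y).
Definition ug_inv (x : U) : U := \pi_U (ug_inv_word (repr x)).

Lemma ug_piP (u v : ug_word M) :
  \pi_U u = \pi_U v <-> eqv_closure ug_rel u v.
Proof. by split=> [/eqmodP|uv]; last exact/eqmodP. Qed.

Lemma ug_rel_eq (u v : ug_word M) : ug_rel u v -> \pi_U u = \pi_U v.
Proof. by move=> uv; apply/ug_piP/asboolP; exact: rst_step. Qed.

Lemma ug_repr (u : ug_word M) : eqv_closure ug_rel (repr (\pi_U u)) u.
Proof. by apply/ug_piP; rewrite reprK. Qed.

Lemma ug_catl (w u v : ug_word M) :
  eqv_closure ug_rel u v -> eqv_closure ug_rel (w ++ u) (w ++ v).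
Proof.
apply: eqv_closure_homo => {}u {}v uv; apply/asboolP/rst_step.
by case: uv => [a b m c|a b m n]; rewrite !(catA w); constructor.
Qed.

Lemma ug_catr (w u v : ug_word M) :
  eqv_closure ug_rel u v -> eqv_closure ug_rel (u ++ w) (v ++ w).
Proof.
apply: (@eqv_closure_homo _ _ _ _ (cat^~ w)) => {}u {}v uv.
apply/asboolP/rst_step.
by case: uv => [a b m c|a b m n]; rewrite -!catA; constructor.
Qed.

Lemma ug_prodE (u v : ug_word M) : ug_prod (\pi_U u) (\pi_U v) = \pi_U (u ++ v).
Proof.
apply/ug_piP; apply: (@eqv_closure_trans _ _ (u ++ repr (\pi_U v))).
  exact/ug_catr/ug_repr.
exact/ug_catl/ug_repr.
Qed.

Lemma ug_ind (P : U -> Prop) : (forall w, P (\pi_U w)) -> forall x, P x.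
Proof. by move=> Ppi x; rewrite -[x]reprK. Qed.

Lemma ug_prodA : associative ug_prod.
Proof.
elim/ug_ind=> u; elim/ug_ind=> v; elim/ug_ind=> w.
by rewrite !ug_prodE catA.
Qed.

Lemma ug_mul1 : left_id ug_one ug_prod.
Proof. by elim/ug_ind=> u; rewrite /ug_one ug_prodE. Qed.

Lemma ug_1mul : right_id ug_one ug_prod.
Proof. by elim/ug_ind=> u; rewrite /ug_one ug_prodE cats0. Qed.

Lemma ug_cat_inv (w : ug_word M) : \pi_U (w ++ ug_inv_word w) = ug_one.
Proof.
elim: w => [//|[m b] w IHw]; rewrite /ug_inv_word /= rev_cons -cats1 catA.
rewrite -cat1s -ug_prodE -[X in ug_prod _ X]ug_prodE IHw ug_mul1 ug_prodE.
exact: (ug_rel_eq (ug_cancel [::] [::] m b)).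
Qed.

Lemma ug_inv_wordK : involutive ug_inv_word.
Proof.
move=> w; rewrite /ug_inv_word map_rev revK -map_comp -[RHS]map_id.
by apply: eq_map => -[m b] /=; rewrite negbK.
Qed.

Lemma ug_mulV : right_inverse ug_one ug_inv ug_prod.
Proof. by move=> x; rewrite /ug_inv -{1}[x]reprK ug_prodE ug_cat_inv. Qed.

Lemma ug_Vmul : left_inverse ug_one ug_inv ug_prod.
Proof.
move=> x; rewrite /ug_inv -{2}[x]reprK ug_prodE.
by rewrite -{2}[repr x]ug_inv_wordK ug_cat_inv.
Qed.

HB.instance Definition _ :=
  isGroup.Build U ug_prodA ug_mul1 ug_1mul ug_Vmul ug_mulV.

Definition ug_gen (m : M) : U := \pi_U [:: (m, false)].

Lemma ug_gen_monoid_morphism : monoid.monoid_morphism ug_gen.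
Proof.
have genM : {morph ug_gen : m n / (m * n)%g}.
  by move=> m n; rewrite [RHS]ug_prodE (ug_rel_eq (ug_mul [::] [::] m n)).
by split=> //; apply: (@mulgI _ (ug_gen 1)); rewrite -genM !mulg1.
Qed.

HB.instance Definition _ :=
  isUMagmaMorphism.Build M U ug_gen ug_gen_monoid_morphism.

End UniversalGroupTheory.

Notation monoid_hom := UMagmaMorphism.type.

Section UniversalGroupFunctor.
Context {M N : monoidType} (f : monoid_hom M N).

Definition ug_map_word (w : ug_word M) : ug_word N :=
  [seq (f a.1, a.2) | a <- w].

Definition ug_map (x : universal_group M) : universal_group N :=
  \pi_(universal_group N) (ug_map_word (repr x)).

Lemma ug_mapE (w : ug_word M) :
  ug_map (\pi_(universal_group M) w) = \pi_(universal_group N) (ug_map_word w).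
Proof.
apply/ug_piP; apply: eqv_closure_homo (ug_repr w) => u v uv.
apply/asboolP/rst_step; case: uv => [a b m c|a b m n];
  rewrite /ug_map_word !map_cat /= ?gmulfM.
- exact: ug_cancel.
- exact: ug_mul.
Qed.

Lemma ug_map_gen (m : M) : ug_map (ug_gen m) = ug_gen (f m).
Proof. exact: ug_mapE. Qed.

Lemma ug_map_monoid_morphism : monoid.monoid_morphism ug_map.
Proof.
split; first exact: ug_mapE.
apply: (@ug_ind M) => u; apply: (@ug_ind M) => v.
by rewrite [X in ug_map X]ug_prodE !ug_mapE [RHS]ug_prodE /ug_map_word map_cat.
Qed.

HB.instance Definition _ :=
  isUMagmaMorphism.Build _ _ ug_map ug_map_monoid_morphism.

End UniversalGroupFunctor.

(* The ordinal 'I_n.+1 with its usual order is the object [n] of the simplex  *)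
(* category, so that a simplicial object is a contravariant functor on these. *)
Notation simplex_hom m n := {omorphism 'I_m.+1 -> 'I_n.+1}.

Record simplicialSet := SimplicialSet {
  sset_obj :> nat -> choiceType;
  sset_act : forall m n, simplex_hom m n -> sset_obj n -> sset_obj m;
  sset_act_id : forall n (x : sset_obj n), sset_act idfun x = x;
  sset_act_comp : forall m n p (f : simplex_hom m n) (g : simplex_hom n p)
    (x : sset_obj p), sset_act (g \o f) x = sset_act f (sset_act g x)
}.

Record simplicialMonoid := SimplicialMonoid {
  smon_obj : nat -> monoidType;
  smon_act : forall m n, simplex_hom m n ->
    monoid_hom (smon_obj n) (smon_obj m);
  smon_act_id : forall n (x : smon_obj n), smon_act idfun x = x;
  smon_act_comp : forall m n p (f : simplex_hom m n) (g : simplex_hom n p)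
    (x : smon_obj p), smon_act (g \o f) x = smon_act f (smon_act g x)
}.

Record simplicialGroup := SimplicialGroup {
  sgrp_obj : nat -> groupType;
  sgrp_act : forall m n, simplex_hom m n -> monoid_hom (sgrp_obj n) (sgrp_obj m);
  sgrp_act_id : forall n (x : sgrp_obj n), sgrp_act idfun x = x;
  sgrp_act_comp : forall m n p (f : simplex_hom m n) (g : simplex_hom n p)
    (x : sgrp_obj p), sgrp_act (g \o f) x = sgrp_act f (sgrp_act g x)
}.

Arguments smon_act {s m n} f.
Arguments sgrp_act {s m n} f.

Definition simplicialGroup_monoid (G : simplicialGroup) : simplicialMonoid :=
  @SimplicialMonoid (@sgrp_obj G) (fun m n => sgrp_act)
    (@sgrp_act_id G) (@sgrp_act_comp G).
Coercion simplicialGroup_monoid : simplicialGroup >-> simplicialMonoid.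

Definition simplicialMonoid_set (M : simplicialMonoid) : simplicialSet :=
  @SimplicialSet (@smon_obj M) (fun m n => smon_act)
    (@smon_act_id M) (@smon_act_comp M).
Coercion simplicialMonoid_set : simplicialMonoid >-> simplicialSet.

Record simplicialMap (X Y : simplicialSet) := SimplicialMap {
  smap_fun :> forall n, X n -> Y n;
  smap_natural : forall m n (f : simplex_hom m n) (x : X n),
    smap_fun (sset_act f x) = sset_act f (smap_fun x)
}.

Record simplicialMonoidMap (M N : simplicialMonoid) := SimplicialMonoidMap {
  smon_map_fun : forall n, monoid_hom (smon_obj M n) (smon_obj N n);
  smon_map_natural : forall m n (f : simplex_hom m n) (x : smon_obj M n),
    smon_map_fun m (smon_act f x) = smon_act f (smon_map_fun n x)
}.

Definition simplicialMonoidMap_map (M N : simplicialMonoid)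
    (h : simplicialMonoidMap M N) : simplicialMap M N :=
  @SimplicialMap M N (smon_map_fun h) (@smon_map_natural M N h).
Coercion simplicialMonoidMap_map : simplicialMonoidMap >-> simplicialMap.

Section SimplicialGroupCompletion.
Context (M : simplicialMonoid).

Lemma completion_act_id n (x : universal_group (smon_obj M n)) :
  ug_map (smon_act idfun) x = x.
Proof.
move: x; apply: ug_ind => w; rewrite ug_mapE; congr (\pi_(_) _).
by rewrite -[RHS]map_id; apply: eq_map => -[m b]; rewrite /= smon_act_id.
Qed.

Lemma completion_act_comp m n p (f : simplex_hom m n) (g : simplex_hom n p)
    (x : universal_group (smon_obj M p)) :
  ug_map (smon_act (g \o f)) x = ug_map (smon_act f) (ug_map (smon_act g) x).
Proof.
move: x; apply: ug_ind => w; rewrite !ug_mapE; congr (\pi_(_) _).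
by rewrite /ug_map_word -map_comp; apply: eq_map => -[a b];
  rewrite /= smon_act_comp.
Qed.

Definition simplicial_universal_group : simplicialGroup :=
  @SimplicialGroup (fun n => universal_group (smon_obj M n))
    (fun m n f => ug_map (smon_act f))
    completion_act_id completion_act_comp.

Lemma ug_gen_natural m n (f : simplex_hom m n) (x : smon_obj M n) :
  ug_gen (smon_act f x) = ug_map (smon_act f) (ug_gen x).
Proof. by rewrite ug_map_gen. Qed.

Definition group_completion : simplicialMonoidMap M simplicial_universal_group :=
  @SimplicialMonoidMap M simplicial_universal_group
    (fun n => @ug_gen (smon_obj M n)) ug_gen_natural.

End SimplicialGroupCompletion.

Definition standard_simplex (R : realType) (n : nat) : set 'rV[R]_n.+1 :=
  [set t | (forall i, 0 <= t ord0 i) /\ \sum_i t ord0 i = 1].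
Arguments standard_simplex : clear implicits.

Section SimplexMap.
Context {R : realType} {m n : nat} (f : simplex_hom m n).

(* The affine map sending the vertex i to the vertex f i.                     *)
Definition simplex_pushforward (t : 'rV[R]_m.+1) : 'rV[R]_n.+1 :=
  \row_j \sum_(i | f i == j) t ord0 i.

Lemma simplex_pushforward_subproof (t : standard_simplex R m) :
  simplex_pushforward (set_val t) \in standard_simplex R n.
Proof.
apply/mem_set; have [t_ge0 t_sum1] := set_mem (valP t); split=> [j|].
  by rewrite mxE; apply: sumr_ge0.
under eq_bigr => j _ do rewrite mxE.
by rewrite -[RHS]t_sum1 [RHS](partition_big f xpredT).
Qed.

Definition simplex_map (t : standard_simplex R m) : standard_simplex R n :=
  @exist _ _ (simplex_pushforward (set_val t)) (simplex_pushforward_subproof t).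

End SimplexMap.

Section Realization.
Context (R : realType) (X : simplicialSet).

Definition realization_cell (n : nat) : topologicalType :=
  (discrete_topology (X n) * standard_simplex R n)%type.

Definition realization_cells : topologicalType :=
  {n : nat & realization_cell n}.

Inductive realization_rel : realization_cells -> realization_cells -> Prop :=
| Realization_glue m n (f : simplex_hom m n) (x : X n)
    (t : standard_simplex R m) :
    realization_rel (existT realization_cell m (sset_act f x, t))
                    (existT realization_cell n (x, simplex_map f t)).

Definition realization : Type := {eq_quot (generated_equiv realization_rel)}.

HB.instance Definition _ :=
  Topological.copy realization (quotient_topology realization).
HB.instance Definition _ := Quotient.on realization.

Lemma realization_piP (c d : realization_cells) :
  \pi_realization c = \pi_realization d <-> eqv_closure realization_rel c d.
Proof.
by split=> [/(@eqmodP _ (generated_equiv _))|cd];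
  last exact/(@eqmodP _ (generated_equiv _)).
Qed.

End Realization.

Section RealizationMap.
Context (R : realType) {X Y : simplicialSet} (h : simplicialMap X Y).

Definition realization_cells_map (c : realization_cells R X) :
    realization_cells R Y :=
  let: existT n (x, t) := c in existT (realization_cell R Y) n (h n x, t).

Definition realization_map (z : realization R X) : realization R Y :=
  \pi_(realization R Y) (realization_cells_map (repr z)).

Lemma realization_mapE (c : realization_cells R X) :
  realization_map (\pi_(realization R X) c) =
  \pi_(realization R Y) (realization_cells_map c).
Proof.
apply/realization_piP.
apply: (@eqv_closure_homo _ _ (@realization_rel R X)).
  move=> _ _ [m n f x t] /=; rewrite smap_natural.
  by apply/asboolP/rst_step; constructor.
by apply/realization_piP; rewrite reprK.
Qed.

Lemma realization_cells_map_continuous : continuous realization_cells_map.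
Proof.
apply/continuousP => A oA; apply/sigT_openP => n; rewrite -comp_preimage.
apply: open_comp => [c _|//].
have -> : realization_cells_map \o existT (realization_cell R X) n =
    existT (realization_cell R Y) n \o (fun c => (h n c.1, c.2)).
  by apply/funext => -[].
apply: continuous_comp; last exact: existT_continuous.
case: c => x t B [[P Q] /= [Px Qt] PQ].
exists ([set x], Q) => /=.
  by split=> //; exact: (@discrete_set1 (discrete_topology (X n))).
by move=> [y s] /= [-> Qs]; apply: PQ; split=> //=; exact: nbhs_singleton Px.
Qed.

Lemma realization_map_continuous : continuous realization_map.
Proof.
apply/quotient_continuous.
have -> : realization_map \o \pi_(realization R X) =
    \pi_(realization R Y) \o realization_cells_map.
  by apply/funext => c; exact: realization_mapE.
move=> c; apply: continuous_comp; last exact: pi_continuous.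
exact: realization_cells_map_continuous.
Qed.

End RealizationMap.
Arguments realization_map R {X Y} h z.

Section Homotopy.
Context (R : realType).

Definition homotopic {X Y : topologicalType} (f g : X -> Y) : Prop :=
  exists H : X * R -> Y,
    [/\ {within [set: X] `*` `[0, 1], continuous H},
        forall x, H (x, 0) = f x & forall x, H (x, 1) = g x].

Definition null_homotopic {X Y : topologicalType} (f : X -> Y) : Prop :=
  exists y : Y, homotopic f (cst y).

Definition contractible (X : topologicalType) : Prop :=
  null_homotopic (@idfun X).

End Homotopy.

(* Main.v *)
From HB Require Import structures.
Require Import Defs.
From mathcomp Require Import all_boot all_order all_algebra.
From mathcomp Require Import all_classical all_reals all_analysis.
From mathcomp Require Import ring lra.
Import Order.TTheory GRing.Theory Num.Theory.
Import numFieldNormedType.Exports.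

Set Implicit Arguments.
Unset Strict Implicit.
Unset Printing Implicit Defensive.

Local Open Scope classical_set_scope.
Local Open Scope ring_scope.

(** Let S be the rectangular band int x int, with (i, l) (j, k) = (i, k), to
    which a unit is adjoined, and let A be the central extension of S by int in
    which the product of (i, l) and (j, k) picks up the integer l * j.  The
    simplicial monoid is the quotient of n |-> A ^ n.+1 (the nerve of the
    indiscrete groupoid on the elements of A, a contractible simplicial set) by
    the diagonal translation action of the central subgroup int.

    That action is free, so the realization is a quotient of a contractible
    space by a free action of int: a circle up to homotopy.  What the proof
    needs of this is connectedness ([ext_realization_connected]), and a map to
    the circle, obtained by averaging the integer coordinates with barycentric
    weights ([circle_coord]), which sends some loop to a loop of degree one.  A
    contraction would deform that loop to a constant one, and the degree cannot
    change during a deformation ([no_null_homotopy_degree1]).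

    On the other hand the group completion is trivial in every degree
    ([ext_gen1]).  Idempotents die in a group, and although the central
    integers are far from idempotent, the cocycle makes them products of
    idempotents: (0, l) and (1, 0) lift to idempotents whose product is (0, 0)
    with central part l.  So the realization of the completion is one point
    ([realization_trivial]), and the completion map is constant. *)

(** * A central extension of a rectangular band *)

Definition band : choiceType := option (int * int).

(** [None] is the adjoined unit. *)
Definition band_mul (s t : band) : band :=
  match s, t with
  | None, _ => t
  | _, None => s
  | Some (i, _), Some (_, m) => Some (i, m)
  end.

(** A 2-cocycle on the band, given by a Rees sandwich matrix l * j. *)
Definition sandwich (s t : band) : int :=
  if (s, t) is (Some (_, l), Some (j, _)) then l * j else 0.

Lemma band_mulA : associative band_mul.
Proof. by move=> [[? ?]|] [[? ?]|] [[? ?]|]. Qed.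

Lemma band_mul1 : left_id None band_mul.
Proof. by case. Qed.

Lemma band_1mul : right_id None band_mul.
Proof. by move=> [[? ?]|]. Qed.

Lemma sandwich_cocycle s t u :
  sandwich s t + sandwich (band_mul s t) u =
  sandwich t u + sandwich s (band_mul t u).
Proof.
move: s t u => [[? ?]|] [[? ?]|] [[? ?]|] //=; rewrite /sandwich; ring.
Qed.

Definition extension : choiceType := (band * int)%type.

(** * The simplicial monoid of tuples modulo translation *)

Section Tuples.
Context {n : nat}.

(** A class of tuples modulo translation of all the integer coordinates is
    represented by its unique member with integer coordinate 0 at vertex 0. *)
Definition ext_simplex : Type :=
  {x : {ffun 'I_n.+1 -> extension} | (x ord0).2 == 0}.

Definition normalize (x : 'I_n.+1 -> extension) : {ffun 'I_n.+1 -> extension} :=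
  [ffun i => ((x i).1, (x i).2 - (x ord0).2)].

Lemma normalize_subproof x : (normalize x ord0).2 == 0.
Proof. by rewrite ffunE subrr. Qed.

Definition ext_class (x : 'I_n.+1 -> extension) : ext_simplex :=
  exist _ (normalize x) (normalize_subproof x).

Definition level (x : ext_simplex) (i : 'I_n.+1) : int := (val x i).2.
Definition shape (x : ext_simplex) (i : 'I_n.+1) : band := (val x i).1.

Lemma level0 x : level x ord0 = 0.
Proof. exact/eqP/(valP x). Qed.

Lemma shape_class x i : shape (ext_class x) i = (x i).1.
Proof. by rewrite /shape ffunE. Qed.

Lemma level_class x i : level (ext_class x) i = (x i).2 - (x ord0).2.
Proof. by rewrite /level ffunE. Qed.

Lemma ext_simplexP x y :
  shape x =1 shape y -> level x =1 level y -> x = y.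
Proof.
move=> xys xyl; apply/val_inj/ffunP => i.
have := xys i; have := xyl i; rewrite /shape /level.
by case: (val x i) (val y i) => [? ?] [? ?] /= -> ->.
Qed.

Definition ext_one : ext_simplex := ext_class (fun=> (None, 0)).

Definition ext_mul (x y : ext_simplex) : ext_simplex :=
  ext_class (fun i => (band_mul (shape x i) (shape y i),
    level x i + level y i + sandwich (shape x i) (shape y i))).

Lemma ext_mulA : associative ext_mul.
Proof.
move=> x y z; apply: ext_simplexP => i; rewrite ?shape_class ?band_mulA //.
rewrite !(level_class, shape_class) /= !level0.
have := sandwich_cocycle (shape x i) (shape y i) (shape z i).
have := sandwich_cocycle (shape x ord0) (shape y ord0) (shape z ord0).
lra.
Qed.

Lemma ext_mul1 : left_id ext_one ext_mul.
Proof.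
move=> x; apply: ext_simplexP => i; rewrite !(level_class, shape_class) //=.
by rewrite !level0 /sandwich /=; ring.
Qed.

Lemma ext_1mul : right_id ext_one ext_mul.
Proof.
move=> x; apply: ext_simplexP => i; rewrite !(level_class, shape_class) /=.
  by rewrite band_1mul.
rewrite !level0 /sandwich /=.
by case: (shape x i) (shape x ord0) => [[? ?]|] [[? ?]|]; ring.
Qed.

HB.instance Definition _ := Choice.on ext_simplex.
HB.instance Definition _ :=
  isMonoid.Build ext_simplex ext_mulA ext_mul1 ext_1mul.

End Tuples.
Arguments ext_simplex : clear implicits.

Section Action.
Context {m n : nat} (f : simplex_hom m n).

Definition ext_act (x : ext_simplex n) : ext_simplex m :=
  ext_class (fun i => val x (f i)).

Lemma shape_act x i : shape (ext_act x) i = shape x (f i).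
Proof. exact: shape_class. Qed.

Lemma level_act x i : level (ext_act x) i = level x (f i) - level x (f ord0).
Proof. exact: level_class. Qed.

Lemma ext_act_monoid_morphism : monoid.monoid_morphism ext_act.
Proof.
split=> [|x y]; apply: ext_simplexP => i;
  rewrite ?(shape_act, level_act, shape_class, level_class) //= !level0.
ring.
Qed.

HB.instance Definition _ :=
  isUMagmaMorphism.Build (ext_simplex n) (ext_simplex m) ext_act
    ext_act_monoid_morphism.

End Action.

Lemma ext_act_id n (x : ext_simplex n) : ext_act idfun x = x.
Proof.
by apply: ext_simplexP => i; rewrite ?shape_act // level_act level0 subr0.
Qed.

Lemma ext_act_comp m n p (f : simplex_hom m n) (g : simplex_hom n p)
  (x : ext_simplex p) : ext_act (g \o f) x = ext_act f (ext_act g x).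
Proof. 
apply: ext_simplexP => i; rewrite ?shape_act // !level_act /=; ring.
Qed.

Definition ext_monoid : simplicialMonoid :=
  @SimplicialMonoid ext_simplex (fun m n f => ext_act f)
    ext_act_id ext_act_comp.

(** * Triviality of the group completion *)

Lemma ug_gen_idempotent (M : monoidType) (e : M) :
  (e * e)%g = e -> ug_gen e = 1%g.
Proof.
move=> ee; apply: (@mulgI _ (ug_gen e)).
by rewrite -gmulfM ee mulg1.
Qed.

Lemma ug_eq1 (M : monoidType) :
  (forall m : M, ug_gen m = 1%g) -> forall x : universal_group M, x = 1%g.
Proof.
move=> gen1; apply: ug_ind; elim=> [//|[m b] w IHw].
rewrite -cat1s -[LHS]ug_prodE IHw; apply: etrans (ug_1mul _) _.
case: b; last exact: gen1.
apply: (@mulgI _ (ug_gen m)); rewrite mulg1 [RHS]gen1.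
apply: etrans (ug_prodE _ _) _.
exact: (ug_rel_eq (ug_cancel [::] [::] m false)).
Qed.

Section UniversalGroupTrivial.
Context {n : nat}.

(* These three elements are idempotent since 0 * 0, 0 * 1 and d i * 0 vanish. *)
Let corner : ext_simplex n := ext_class (fun=> (Some (0, 0), 0)).
Let unit_column : ext_simplex n := ext_class (fun=> (Some (1, 0), 0)).
Let level_row (d : 'I_n.+1 -> int) : ext_simplex n :=
  ext_class (fun i => (Some (0, d i), 0)).

(** Multiplying by the idempotent [corner] on both sides replaces the band
    coordinates of x by (0, 0) and keeps its levels, because the cocycle
    vanishes when l = 0 or j = 0.  The result is a product of two idempotents,
    the levels being produced by the cocycle d i * 1. *)
Lemma ext_gen1 (x : ext_simplex n) : ug_gen x = 1%g.
Proof.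
have c1 : ug_gen corner = 1%g.
  apply: ug_gen_idempotent; apply: ext_simplexP => i;
  rewrite !(level_class, shape_class) /sandwich //=; ring.
have l1 : ug_gen unit_column = 1%g.
  apply: ug_gen_idempotent; apply: ext_simplexP => i;
  rewrite !(level_class, shape_class) /sandwich //=; ring.
have r1 d : ug_gen (level_row d) = 1%g.
  apply: ug_gen_idempotent; apply: ext_simplexP => i;
  rewrite !(level_class, shape_class) /sandwich //=; ring.
have E : (corner * x * corner = level_row (level x) * unit_column)%g.
  apply: ext_simplexP => i; rewrite !(level_class, shape_class) /sandwich /=.
    by case: (shape x i) => [[? ?]|].
  rewrite !level0.
  by case: (shape x i) (shape x ord0) => [[? ?]|] [[? ?]|] /=; ring.
have := congr1 (@ug_gen _) E; rewrite !gmulfM /= c1 l1 r1.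
by rewrite !mulg1 mul1g.
Qed.

End UniversalGroupTrivial.
(** * Homotopy invariance of the degree of a loop in the circle *)

Lemma continuous_pair (X Y Z : topologicalType) (f : X -> Y) (g : X -> Z) :
  continuous f -> continuous g -> continuous (fun x => (f x, g x)).
Proof. by move=> cf cg x; exact: (cvg_pair (cf x) (cg x)). Qed.

Section Circle.
Context {R : realType}.

(** Retraction of the line onto the unit interval; precomposing with it replaces
    continuity within the interval by continuity everywhere. *)
Definition clamp (s : R) : R := Num.max 0 (Num.min s 1).

Lemma clamp_itv s : 0 <= clamp s <= 1.
Proof. by rewrite /clamp le_max lexx /= ge_max ler01 ge_min lexx orbT. Qed.

Lemma clamp_id s : 0 <= s <= 1 -> clamp s = s.
Proof. by move=> /andP[s0 s1]; rewrite /clamp (min_idPl s1) (max_idPr s0). Qed.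

Lemma clamp_continuous : continuous clamp.
Proof.
move=> s.
apply: (@continuous_max R R (cst 0) (id \min cst 1)); first exact: cvg_cst.
by apply: (@continuous_min R R id (cst 1)); [exact: cvg_id|exact: cvg_cst].
Qed.

Lemma cos_sin_atan (x y : R) : 0 < x -> x ^+ 2 + y ^+ 2 = 1 ->
  cos (atan (y / x)) = x /\ sin (atan (y / x)) = y.
Proof.
move=> x_gt0 xy1; have x0 : x != 0 by rewrite gt_eqF.
have cx : cos (atan (y / x)) = x.
  rewrite cos_atan; have -> : 1 + (y / x) ^+ 2 = x^-1 ^+ 2.
    transitivity ((x ^+ 2 + y ^+ 2) / x ^+ 2); first by field.
    by rewrite xy1 mul1r exprVn.
  by rewrite sqrtr_sqr ger0_norm ?invr_ge0 ?ltW// invrK.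
split=> //; have := atanK (y / x); rewrite /tan cx.
by move=> /(congr1 ( *%R^~ x)); rewrite !mulfVK.
Qed.

Lemma cos_sinDz (t : R) (k : int) :
  cos (t + pi *+ 2 * k%:~R) = cos t /\ sin (t + pi *+ 2 * k%:~R) = sin t.
Proof.
wlog: t k / 0 <= k => [th|].
  have [/th//|k_lt0] := leP 0 k.
  have := th (t + pi *+ 2 * k%:~R) (- k); rewrite oppr_ge0 ltW //.
  by rewrite rmorphN /= mulrN addrK => /(_ isT)[-> ->].
case: k => // k _; rewrite -pmulrn mulr_natr.
split; [exact: (periodicn (@cosD2pi R))|exact: (periodicn (@sinD2pi R))].
Qed.

(** For a loop (p, q) in the unit circle, this says that its degree is zero. *)
Definition null_lift (p q : R -> R) : Prop :=
  exists2 L : R -> R, continuous L &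
    L 0 = L 1 /\ forall s, p s = cos (L s) /\ q s = sin (L s).

(** If the two loops are never at a right angle or more, then their quotient, as
    a complex number x + i y, stays in the half-plane x > 0, where atan (y / x)
    is a continuous angle.  Adding it to a lift of the first loop lifts the
    second one. *)
Lemma null_lift_close (p q p' q' : R -> R) :
  continuous p -> continuous q -> continuous p' -> continuous q' ->
  p' 0 = p' 1 -> q' 0 = q' 1 ->
  (forall s, p' s ^+ 2 + q' s ^+ 2 = 1) ->
  (forall s, 0 < p s * p' s + q s * q' s) ->
  null_lift p q -> null_lift p' q'.
Proof.
move=> cp cq cp' cq' p'01 q'01 unit' close [L cL [L01 pqL]].
pose x s := p s * p' s + q s * q' s.
pose y s := p s * q' s - q s * p' s.
have cx : continuous x.
  move=> s; apply: cvgD; apply: cvgM;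
    by [exact: cp|exact: cp'|exact: cq|exact: cq'].
have cy : continuous y.
  move=> s; apply: cvgB; apply: cvgM;
    by [exact: cp|exact: cq'|exact: cq|exact: cp'].
exists (fun s => L s + atan (y s / x s)).
  move=> s; apply: cvgD; first exact: cL.
  apply: continuous_comp; last exact: continuous_atan.
  apply: cvgM; first exact: cy.
  by apply: cvgV; [rewrite gt_eqF ?close|exact: cx].
have pq s : p s ^+ 2 + q s ^+ 2 = 1 by have [-> ->] := pqL s; exact: cos2Dsin2.
split.
  have [p0 q0] := pqL 0; have [p1 q1] := pqL 1.
  by rewrite /x /y p0 p1 q0 q1 p'01 q'01 L01.
move=> s; have xy1 : x s ^+ 2 + y s ^+ 2 = 1.
  have -> : x s ^+ 2 + y s ^+ 2 =
    (p s ^+ 2 + q s ^+ 2) * (p' s ^+ 2 + q' s ^+ 2) by rewrite /x /y; ring.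
  by rewrite pq unit' mulr1.
have [cosA sinA] := cos_sin_atan (close s) xy1.
rewrite cosD sinD cosA sinA; have [<- <-] := pqL s.
split.
  transitivity ((p s ^+ 2 + q s ^+ 2) * p' s); first by rewrite pq mul1r.
  by rewrite /x /y; ring.
transitivity ((p s ^+ 2 + q s ^+ 2) * q' s); first by rewrite pq mul1r.
by rewrite /x /y; ring.
Qed.

(** The difference F between a closed lift and 2 pi s is a multiple of 2 pi, but
    it drops by 2 pi from s = 0 to s = 1, so it takes the value F 0 - pi. *)
Lemma degree1_no_null_lift (p q : R -> R) :
  (forall s, 0 <= s <= 1 ->
    p s = cos (pi *+ 2 * s) /\ q s = sin (pi *+ 2 * s)) ->
  ~ null_lift p q.
Proof.
move=> pq [L cL [L01 pqL]].
pose F s := L s - pi *+ 2 * s.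
have cF : continuous F.
  move=> s; apply: cvgB; first exact: cL.
  by apply: cvgM; [exact: cvg_cst|exact: cvg_id].
have cosF s : 0 <= s <= 1 -> cos (F s) = 1.
  move=> s01; have [pc qs] := pq _ s01; have [pL qL] := pqL s.
  by rewrite /F cosB -pL -qL pc qs -!expr2 cos2Dsin2.
have pi_gt0 := pi_gt0 R.
have F0 : F 0 = L 0 by rewrite /F mulr0 subr0.
have F1 : F 1 = L 0 - pi *+ 2 by rewrite /F mulr1 L01.
have [|||c c01 Fc] := @IVT R F 0 1 (F 0 - pi).
- exact: ler01.
- exact: continuous_subspaceT.
- rewrite F1 F0 ge_min le_max.
  by apply/andP; split; apply/orP; [right|left]; lra.
have c01' : 0 <= c <= 1 by move: c01; rewrite in_itv.
have := cosF _ c01'; rewrite Fc cosB cospi sinpi (cosF 0) ?lexx ?ler01//.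
by lra.
Qed.

(** The loop at time t is s |-> (p (s, t), q (s, t)).  Compactness of the unit
    interval makes the loops at nearby times uniformly close, so that the set of
    times at which the loop has degree zero is open and closed in the line. *)
Lemma no_null_homotopy_degree1 (p q : R * R -> R) (a : R) :
  continuous p -> continuous q ->
  (forall z, p z ^+ 2 + q z ^+ 2 = 1) ->
  (forall t, p (0, t) = p (1, t) /\ q (0, t) = q (1, t)) ->
  (forall s, 0 <= s <= 1 ->
    p (s, 0) = cos (pi *+ 2 * s) /\ q (s, 0) = sin (pi *+ 2 * s)) ->
  (forall s, 0 <= s <= 1 -> p (s, 1) = cos a /\ q (s, 1) = sin a) ->
  False.
Proof.
move=> cp cq unit pq01 start stop.
pose P t s := p (clamp s, t); pose Q t s := q (clamp s, t).
have cont1 (f : R * R -> R) t : continuous f ->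
    continuous (fun s => f (clamp s, t)).
  move=> cf s.
  apply: (@continuous_comp _ _ _ (fun s => (clamp s, t)) f); last exact: cf.
  apply: continuous_pair; first exact: clamp_continuous.
  by move=> ?; exact: cvg_cst.
have cont2 (f : R * R -> R) (t : R) : continuous f ->
    continuous (fun z : R * R => f (z.1, t)).
  move=> cf z; 
  apply: (@continuous_comp _ _ _ (fun z : R * R => (z.1, t)) f); last exact: cf.
  apply: continuous_pair; first by move=> ?; exact: cvg_fst.
  by move=> ?; exact: cvg_cst.
have close t : \forall t' \near t,
    forall s, 0 < P t s * P t' s + Q t s * Q t' s.
  pose D t' s := 0 < p (s, t) * p (s, t') + q (s, t) * q (s, t').
  have : \forall t' \near t, `[0, 1]%classic `<=` D t'.
    have near01 := proj1 (compact_near_coveringP _) (@segment_compact R 0 1).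
    apply: (near01 R (nbhs t) D) => s _.
    pose g (z : R * R) := p (z.1, t) * p z + q (z.1, t) * q z.
    have cg : continuous g.
      by move=> z; exact: (cvgD (cvgM (cont2 p t cp z) (cp z))
                               (cvgM (cont2 q t cq z) (cq z))).
    have g1 : g (s, t) = 1 by rewrite /g /= -!expr2 unit.
    have : \forall z \near (s, t), 0 < g z.
      by apply: (cvgr_gt _ (cg (s, t))); rewrite g1 ltr01.
    by apply: filterS => -[].
  by apply: filterS => t' Dt' s; apply: Dt'; rewrite /= in_itv /= clamp_itv.
have step t t' : (forall s, 0 < P t s * P t' s + Q t s * Q t' s) ->
    null_lift (P t) (Q t) -> null_lift (P t') (Q t').
  have [c0 c1] : clamp 0 = 0 /\ clamp 1 = 1.
    by split; apply: clamp_id; rewrite lexx ler01.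
  by move=> Pt; apply: null_lift_close => //;
    rewrite ?/P ?/Q ?c0 ?c1; try exact: cont1; have [] := pq01 t'.
have openE : [set t | null_lift (P t) (Q t)] = setT.
  apply: (proj2 (@connected_intervalP R setT)).
  - by move=> ? ? *.
  - exists 1; exists (fun=> a); first by move=> ?; exact: cvg_cst.
    by split=> // s; apply: stop; exact: clamp_itv.
  - exists [set t | null_lift (P t) (Q t)]; last by rewrite setTI.
    rewrite openE => t /= lt; apply: filterS (close t) => t' /step; exact.
  - exists [set t | null_lift (P t) (Q t)]; last by rewrite setTI.
    rewrite -[X in closed X]setCK; apply: open_closedC.
    rewrite openE => t /= lt; apply: filterS (close t) => t' tt' lt'; apply: lt.
    by apply: step lt' => s; rewrite mulrC [X in _ + X]mulrC.
have : [set t | null_lift (P t) (Q t)] 0 by rewrite openE.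
apply: degree1_no_null_lift => s s01; rewrite /P /Q clamp_id //; exact: start.
Qed.

End Circle.

(** * Points and paths in a realization *)

Section Simplices.
Context {R : realType}.

Lemma vertex_subproof n (i : 'I_n.+1) :
  (delta_mx ord0 i : 'rV[R]_n.+1) \in standard_simplex R n.
Proof.
apply/mem_set; split=> [j|]; first by rewrite mxE ler0n.
rewrite (bigD1 i) //= big1 ?addr0 ?mxE ?eqxx // => j /negbTE ji.
by rewrite mxE ji andbF.
Qed.

Definition vertex n (i : 'I_n.+1) : standard_simplex R n :=
  @exist _ (fun x => x \in standard_simplex R n) _ (vertex_subproof i).

Lemma simplex_map_vertex m n (f : simplex_hom m n) (i : 'I_m.+1) :
  simplex_map f (vertex i) = vertex (f i).
Proof.
apply/val_inj/rowP => j; rewrite !mxE /= eq_sym big_mkcond (bigD1 i) //= big1.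
  by rewrite mxE !eqxx addr0; case: eqP.
by move=> k /negbTE ki; rewrite mxE ki andbF; case: ifP.
Qed.

Lemma simplex0_eq (t u : standard_simplex R 0) : t = u.
Proof.
apply/val_inj/rowP => i; rewrite !ord1.
have [_] := set_mem (valP t); have [_] := set_mem (valP u).
by rewrite !big_ord1 => -> ->.
Qed.

Section Segment.
Context {n : nat} (t u : standard_simplex R n).

Lemma segment_subproof s :
  \val t + clamp s *: (\val u - \val t) \in standard_simplex R n.
Proof.
have [t_ge0 t1] := set_mem (valP t); have [u_ge0 u1] := set_mem (valP u).
have /andP[s_ge0 s_le1] := clamp_itv s.
apply/mem_set; split=> [i|].
  rewrite !mxE; have := t_ge0 i; have := u_ge0 i; nra.
under eq_bigr do rewrite !mxE.
by rewrite big_split -mulr_sumr big_split sumrN /= t1 u1 subrr mulr0 addr0.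
Qed.

Definition segment s : standard_simplex R n :=
  @exist _ (fun x => x \in standard_simplex R n) _ (segment_subproof s).

Lemma segment_continuous : continuous segment.
Proof.
apply: continuous_comp_initial => s.
apply: cvgD; first exact: cvg_cst.
by apply: cvgZr_tmp; exact: clamp_continuous.
Qed.

Lemma segment0 : segment 0 = t.
Proof.
by apply/val_inj; rewrite /= clamp_id ?lexx ?ler01// scale0r addr0.
Qed.

Lemma segment1 : segment 1 = u.
Proof.
by apply/val_inj; rewrite /= clamp_id ?lexx ?ler01// scale1r addrC subrK.
Qed.

End Segment.
End Simplices.

Section RealizationCells.
Context (R : realType) (X : simplicialSet).

Definition cell_point n (x : X n) (t : standard_simplex R n) : realization R X :=
  \pi_(realization R X)%qT (existT (realization_cell R X) n (x, t)).

Lemma cell_point_glue m n (f : simplex_hom m n) (x : X n)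
    (t : standard_simplex R m) :
  cell_point (sset_act f x) t = cell_point x (simplex_map f t).
Proof. by apply/realization_piP/asboolP/Relation_Operators.rst_step. Qed.

Lemma cell_pointP (P : realization R X -> Prop) :
  (forall n (x : X n) t, P (cell_point x t)) -> forall z, P z.
Proof.
by move=> cellP z; rewrite -[z]reprK; case: (repr z) => n [x t]; exact: cellP.
Qed.

Lemma cell_point_continuous n (x : X n) : continuous (cell_point x).
Proof.
move=> t; apply: (@continuous_comp _ _ _
  (fun t => existT (realization_cell R X) n (x, t)) \pi_(realization R X)%qT);
  last exact: pi_continuous.
apply: (@continuous_comp _ _ _
  (fun t => (x, t) : realization_cell R X n) (existT _ n));
  last exact: existT_continuous.
apply: (@continuous_pair _ (discrete_topology (X n)) _ (fun=> x) id).
  exact: cst_continuous.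
by move=> ?; exact: cvg_id.
Qed.

Lemma cell_path_continuous n (x : X n) t u :
  continuous (cell_point x \o segment t u).
Proof.
move=> s; apply: continuous_comp; first exact: segment_continuous.
exact: cell_point_continuous.
Qed.

Lemma cell_component n (x : X n) t u :
  connected_component [set: realization R X] (cell_point x t) (cell_point x u).
Proof.
exists ((cell_point x \o segment t u) @` [set: R]).
  split=> //; first by exists 0; rewrite //= segment0.
  apply: connected_continuous_connected.
    by apply/connected_intervalP => ? ? *.
  exact/continuous_subspaceT/cell_path_continuous.
by exists 1; rewrite //= segment1.
Qed.

End RealizationCells.

Section ConstantHom.
Context (m n : nat) (i : 'I_n.+1).

Definition constant_hom_fun (_ : 'I_m.+1) : 'I_n.+1 := i.

Lemma constant_hom_homo : {homo constant_hom_fun : j k / (j <= k)%O}.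
Proof. by move=> *; exact: le_refl. Qed.

HB.instance Definition _ :=
  Order.isOrderMorphism.Build _ _ _ _ constant_hom_fun constant_hom_homo.

Definition constant_hom : simplex_hom m n := constant_hom_fun.

End ConstantHom.

(** Both degeneracies to and faces from degree 0 are bijective, so each cell is
    glued to the single point of the cell in degree 0. *)
Lemma realization_trivial (R : realType) (X : simplicialSet)
    (z w : realization R X) :
  (forall n (x y : X n), x = y) -> z = w.
Proof.
move=> X1; have point n (x : X n) t :
    cell_point x t = cell_point (sset_act (constant_hom 0 ord0) x) (vertex ord0).
  rewrite (X1 _ x (sset_act (constant_hom n ord0)
                     (sset_act (constant_hom 0 ord0) x))).
  rewrite cell_point_glue; congr cell_point; first exact: X1.
  exact: simplex0_eq.
elim/cell_pointP: z => n x t; elim/cell_pointP: w => m y u.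
by rewrite point [RHS]point; congr cell_point; exact: X1.
Qed.

(** * The realization is connected and maps to the circle *)

(** Each cell contains its initial vertex y, which the edge e joins to the unit:
    any two elements of S span an edge with integer coordinates 0. *)
Lemma ext_realization_connected (R : realType) :
  connected [set: realization R ext_monoid].
Proof.
pose base : realization R ext_monoid :=
  cell_point (1%g : ext_monoid 0) (vertex ord0).
suff -> : [set: realization R ext_monoid] = connected_component setT base.
  exact: component_connected.
apply/seteqP; split=> // z _; elim/cell_pointP: z => n x t.
pose y : ext_monoid 0 := ext_act (constant_hom 0 ord0) x.
pose e : ext_monoid 1 :=
  ext_class (fun i => (if i == ord0 then None else shape y ord0, 0)).
apply: (connected_component_trans (y := cell_point e (vertex ord0))).
  have -> : base = cell_point e (simplex_map (constant_hom 0 ord0) (vertex ord0)).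
    rewrite -cell_point_glue; congr cell_point; apply: ext_simplexP => i;
    by rewrite ?(shape_act, shape_class, level_act, level_class) ?subrr.
  by rewrite simplex_map_vertex; exact: cell_component.
apply: (connected_component_trans (y := cell_point e (vertex ord_max))).
  exact: cell_component.
apply: (connected_component_trans (y := cell_point x (vertex ord0))); last first.
  exact: cell_component.
have -> : cell_point e (vertex ord_max) =
    cell_point x (simplex_map (constant_hom 0 ord0) (vertex ord0))
    :> realization R ext_monoid.
  rewrite -cell_point_glue -[ord_max]/(constant_hom 0 ord_max ord0).
  rewrite -simplex_map_vertex -cell_point_glue; congr cell_point.
  apply: ext_simplexP => i;
  by rewrite ?(shape_act, shape_class, level_act, level_class) /=
             ?ord1 ?level0 ?subrr.
by rewrite simplex_map_vertex; exact: cell_component.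
Qed.

Section CircleMap.
Context {R : realType}.

Definition mean_level n (x : ext_simplex n) (t : standard_simplex R n) : R :=
  \sum_i (\val t) ord0 i * (level x i)%:~R.

(** The weights sum to 1, so renormalizing the levels at a new initial vertex
    shifts their mean by an integer: the mean is well defined modulo integers
    on the realization. *)
Lemma mean_level_glue m n (f : simplex_hom m n) (x : ext_simplex n)
    (t : standard_simplex R m) :
  mean_level x (simplex_map f t) =
  mean_level (ext_act f x) t + (level x (f ord0))%:~R.
Proof.
have [_ t1] := set_mem (valP t).
have -> : (level x (f ord0))%:~R =
    \sum_i \val t ord0 i * (level x (f ord0))%:~R :> R.
  by rewrite -mulr_suml t1 mul1r.
rewrite -big_split /=.
rewrite [RHS](partition_big f xpredT) //=; apply: eq_bigr => j _.
rewrite mxE mulr_suml; apply: eq_bigr => i /eqP <-.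
by rewrite level_act rmorphB /= -mulrDr subrK.
Qed.

Lemma mean_level_continuous n (x : ext_simplex n) : continuous (mean_level x).
Proof.
apply: (@continuous_big R _ +%R 0 xpredT) => [|i _]; first exact: add_continuous.
have coord : continuous (fun t : standard_simplex R n => \val t ord0 i).
  move=> t; apply: (@continuous_comp (standard_simplex R n) 'rV[R]_n.+1 R set_val
    (fun M => M ord0 i)); first exact: initial_continuous.
  exact: coord_continuous.
move=> t; exact: (@cvgM _ _ (nbhs t) _ _ _ _ _ (coord t) (cvg_cst _)).
Qed.

(* The functions cos and sin are the two instances of h, and together they give
   a map to the unit circle. *)
Context (h : R -> R)
  (h_periodic : forall t (k : int), h (t + pi *+ 2 * k%:~R) = h t).

Definition cells_circle (c : realization_cells R ext_monoid) : R :=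
  let: existT n (x, t) := c in h (pi *+ 2 * mean_level x t).

Definition circle_coord (z : realization R ext_monoid) : R :=
  cells_circle (repr z).

Lemma cells_circle_pi (c : realization_cells R ext_monoid) :
  circle_coord (\pi_(realization R ext_monoid)%qT c) = cells_circle c.
Proof.
have /realization_piP/asboolP := reprK (\pi_(realization R ext_monoid)%qT c).
rewrite /circle_coord; move: (repr _) => d.
elim=> {c d} [_ _ [m n f x t]|//|//|x y w _ xy _ yw]; last exact: etrans yw.
by rewrite /= mean_level_glue mulrDr h_periodic.
Qed.

Lemma circle_coordE n (x : ext_simplex n) t :
  circle_coord (cell_point (x : ext_monoid n) t) = h (pi *+ 2 * mean_level x t).
Proof. exact: cells_circle_pi. Qed.

Lemma circle_coord_continuous : continuous h -> continuous circle_coord.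
Proof.
move=> ch; apply/quotient_continuous.
have -> : circle_coord \o \pi_(realization R ext_monoid)%qT = cells_circle.
  by apply/funext => c; exact: cells_circle_pi.
move=> [n [x t]] U Uh.
have /= ct : {for t, continuous (fun t => h (pi *+ 2 * mean_level x t))}.
  apply: (@continuous_comp _ _ _ (mean_level x) (fun r => h (pi *+ 2 * r))).
    exact: mean_level_continuous.
  apply: continuous_comp; last exact: ch.
  by apply: cvgM; [exact: cvg_cst|exact: cvg_id].
exists ([set x], [set u | U (h (pi *+ 2 * mean_level x u))]) => /=.
  by split; [exact: (@discrete_set1 (discrete_topology (ext_monoid n)))|exact: ct].
by move=> [_ u] /= [-> Uu].
Qed.

End CircleMap.

(** * Noncontractibility *)

Lemma within_continuous_comp (X Y Z : topologicalType) (A : set Y)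
    (f : Y -> Z) (g : X -> Y) :
  {within A, continuous f} -> continuous g -> (forall x, A (g x)) ->
  continuous (f \o g).
Proof.
move=> cf cg Ag x U Ufg.
have : @nbhs_subspace _ A (g x) (f @^-1` U) := cf (g x) U Ufg.
rewrite -(nbhs_subspace_in (Ag x)) => /cg.
by apply: (@filterS _ (nbhs x)) => y /(_ (Ag y)).
Qed.

(** The edge x1 has levels 0 and 1 and both its vertices are the unit, so it is a
    loop that [circle_coord] winds once around the circle. *)
Lemma ext_realization_noncontractible (R : realType) :
  ~ contractible R (realization R ext_monoid).
Proof.
move=> [y0 [H [cH H0 H1]]].
pose x1 : ext_monoid 1 := ext_class (fun i => (None, (i : nat)%:Z)).
pose loop : R -> realization R ext_monoid :=
  cell_point x1 \o segment (vertex ord0) (vertex ord_max).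
have endpoint i : cell_point x1 (vertex i) =
    cell_point (1%g : ext_monoid 0) (vertex ord0) :> realization R ext_monoid.
  rewrite -[i]/(constant_hom 0 i ord0) -simplex_map_vertex -cell_point_glue.
  congr cell_point; apply: ext_simplexP => j;
  by rewrite ?(shape_act, shape_class, level_act, level_class) ?subrr.
have loop01 : loop 0 = loop 1.
  by rewrite /loop /= segment0 segment1 !endpoint.
pose G (z : R * R) := H (loop z.1, clamp z.2).
have cG : continuous G.
  apply: (within_continuous_comp cH); last first.
    by move=> z; split=> //=; rewrite in_itv /= clamp_itv.
  apply: continuous_pair => z.
    apply: (@continuous_comp _ _ _ fst loop); first exact: cvg_fst.
    exact: cell_path_continuous.
  apply: (@continuous_comp _ _ _ snd clamp); first exact: cvg_snd.
  exact: clamp_continuous.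
have [c0 c1] : clamp (0 : R) = 0 /\ clamp (1 : R) = 1.
  by split; apply: clamp_id; rewrite lexx ler01.
have cos_per t k := (@cos_sinDz R t k).1.
have sin_per t k := (@cos_sinDz R t k).2.
have G0 s : 0 <= s <= 1 -> exists2 t, G (s, 0) = cell_point x1 t
    & mean_level (x1 : ext_simplex 1) t = s.
  move=> s01; exists (segment (vertex ord0) (vertex ord_max) s).
    by rewrite /G /= c0 H0.
  rewrite /mean_level big_ord_recl big_ord1 !level_class /= !mxE /= clamp_id //.
  by rewrite subrr mulr0z mulr0 !add0r !subr0 mulr1 [LHS]mulr1.
have [n [x [t y0E]]] : exists n (x : ext_monoid n) t, y0 = cell_point x t.
  by elim/cell_pointP: y0 {H1} => n x t; exists n, x, t.
apply: (@no_null_homotopy_degree1 R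
  (circle_coord cos \o G) (circle_coord sin \o G)
  (pi *+ 2 * mean_level (x : ext_simplex n) t)).
- move=> z; apply: continuous_comp; first exact: cG.
  by apply: circle_coord_continuous => //; exact: continuous_cos.
- move=> z; apply: continuous_comp; first exact: cG.
  by apply: circle_coord_continuous => //; exact: continuous_sin.
- move=> z /=; elim/cell_pointP: (G z) => m y u.
  by rewrite !circle_coordE //; exact: cos2Dsin2.
- by move=> s; rewrite /G /= loop01.
- by move=> s /G0[u /= -> us]; rewrite !circle_coordE // us.
- by move=> s _; rewrite /= /G /= c1 H1 y0E !circle_coordE.
Qed.

Theorem mainTheorem1 (R : realType) :
  exists M : simplicialMonoid,
    [/\ connected [set: realization R M],
        ~ contractible R (realization R M)
      & null_homotopic R (realization_map R (group_completion M))].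
Proof.
exists ext_monoid; split.
- exact: ext_realization_connected.
- exact: ext_realization_noncontractible.
have all_eq (z w : realization R (simplicial_universal_group ext_monoid)) :
    z = w.
  apply: realization_trivial => n x y.
  by rewrite (ug_eq1 ext_gen1 x) (ug_eq1 ext_gen1 y).
pose y : realization R (simplicial_universal_group ext_monoid) :=
  cell_point (1%g : simplicial_universal_group ext_monoid 0) (vertex ord0).
exists y, (fun=> y); split=> [|z|z]; [|exact: all_eq|exact: all_eq].
by apply: continuous_subspaceT => z; exact: cvg_cst.
Qed.
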